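(* Let $\mathcal{C},\mathcal{D}$ be distributive coinflip Markov categories, and suppose $F:\mathcal{C}\to\mathcal{D}$ is a Markov functor which preserves (finite) coproducts and the monoidal unit. Then $F$ also preserves the coinflip structure, i.e. $F(m(f,g))=m(F(f),F(g))$ for all $f,g\in\mathcal{C}(X,Y)$ and all objects $X,Y$ of $\mathcal{C}$, where $m$ denotes the (unique) coinflip structure of $\mathcal{C}$, respectively $\mathcal{D}$.
   Context: A Markov category is a symmetric monoidal category $(\mathcal{C},\otimes,I)$ in which every object $X$ is equipped with a commutative comonoid structure $(\mathrm{copy}_X: X\to X\otimes X,\ \mathrm{del}_X : X\to I)$ with $\mathrm{del}_{X\otimes Y}=\mathrm{del}_X\otimes \mathrm{del}_Y$ and $\mathrm{copy}_{X\otimes Y}=(X\otimes \sigma_{X,Y}\otimes Y)(\mathrm{copy}_X\otimes \mathrm{copy}_Y)$ ($\sigma$ the symmetry), and with $\mathrm{del}$ natural. Structural isomorphisms are suppressed. A morphism $f:X\to Y$ is deterministic if $\mathrm{copy}_Y f=(f\otimes f)\mathrm{copy}_X$; the deterministic morphisms form a Cartesian monoidal subcategory $\mathcal{C}_{\mathrm{det}}$. A Markov functor is a strong symmetric monoidal functor $F$ such that $F(X)\xrightarrow{F(\mathrm{copy}_X)}F(X\otimes X)\cong F(X)\otimes F(X)$ equals $\mathrm{copy}_{F(X)}$. A Markov category $\mathcal{C}$ is distributive if $\mathcal{C}_{\mathrm{det}}$ admits finite coproducts and these are preserved by the inclusion $\mathcal{C}_{\mathrm{det}}\hookrightarrow\mathcal{C}$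 and by the tensors $A\otimes -$. A midpoint algebra (in sets) is a set $A$ with $m:A\times A\to A$ satisfying $m(a,a)=a$, $m(a,b)=m(b,a)$, $m(m(a,b),m(c,d))=m(m(a,c),m(b,d))$; a midpoint homomorphism is a map commuting with $m$. A coinflip structure on a Markov category is a midpoint algebra structure on each hom-set $\mathcal{C}(X,Y)$ such that all pre- and postcomposition maps are midpoint homomorphisms; it is unique if it exists. A coinflip Markov category is a Markov category admitting a coinflip structure. *)

(* Defs.v *)
From Stdlib Require ProofIrrelevance.
From mathcomp Require Import all_boot.

Set Implicit Arguments.
Unset Strict Implicit.
Unset Printing Implicit Defensive.

Declare Scope cat_scope.
Delimit Scope cat_scope with cat.
Local Open Scope cat_scope.

Reserved Notation "g ∘ f" (at level 40, left associativity).
Reserved Notation "X ⊗ Y" (at level 39, right associativity).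
Reserved Notation "f ⊗₁ g" (at level 39, right associativity).

(** * Categories and functors *)

Record category := Category {
  obj :> Type;
  hom : obj -> obj -> Type;
  idm : forall X, hom X X;
  compm : forall X Y Z, hom Y Z -> hom X Y -> hom X Z;
  compm_idl : forall X Y (f : hom X Y), compm (idm Y) f = f;
  compm_idr : forall X Y (f : hom X Y), compm f (idm X) = f;
  compmA : forall X Y Z W (h : hom Z W) (g : hom Y Z) (f : hom X Y),
    compm h (compm g f) = compm (compm h g) f }.

Arguments hom {c}.
Arguments idm {c}.
Notation "g ∘ f" := (compm g f) : cat_scope.

Record iso (C : category) (X Y : C) := Iso {
  iso_hom :> hom X Y;
  iso_inv : hom Y X;
  iso_invK : iso_inv ∘ iso_hom = idm X;
  iso_homK : iso_hom ∘ iso_inv = idm Y }.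

Record functor (C D : category) := Functor {
  fobj :> C -> D;
  fmap : forall X Y : C, hom X Y -> hom (fobj X) (fobj Y);
  fmap_id : forall X : C, fmap (idm X) = idm (fobj X);
  fmap_comp : forall (X Y Z : C) (g : hom Y Z) (f : hom X Y),
    fmap (g ∘ f) = fmap g ∘ fmap f }.

Arguments fmap {C D} F {X Y} f : rename.

(** * Finite coproducts *)

Definition is_coproduct (C : category) (n : nat) (X : 'I_n -> C) (P : C)
    (i : forall k, hom (X k) P) : Prop :=
  forall (Z : C) (f : forall k, hom (X k) Z),
    exists! h : hom P Z, forall k, h ∘ i k = f k.

Definition has_finite_coproducts (C : category) : Prop :=
  forall (n : nat) (X : 'I_n -> C),
    exists (P : C) (i : forall k, hom (X k) P), is_coproduct i.

Definition preserves_finite_coproducts (C D : category) (F : functor C D)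
    : Prop :=
  forall (n : nat) (X : 'I_n -> C) (P : C) (i : forall k, hom (X k) P),
    is_coproduct i -> is_coproduct (fun k => fmap F (i k)).

(** * Symmetric monoidal categories *)

Record sym_monoidal_category := SymMonoidalCategory {
  smc_cat :> category;
  tens : smc_cat -> smc_cat -> smc_cat;
  tensm : forall X X' Y Y' : smc_cat,
    hom X X' -> hom Y Y' -> hom (tens X Y) (tens X' Y');
  munit : smc_cat;
  massoc : forall X Y Z : smc_cat,
    iso (tens (tens X Y) Z) (tens X (tens Y Z));
  mlunit : forall X : smc_cat, iso (tens munit X) X;
  mrunit : forall X : smc_cat, iso (tens X munit) X;
  msym : forall X Y : smc_cat, hom (tens X Y) (tens Y X);
  tensm_id : forall X Y, tensm (idm X) (idm Y) = idm (tens X Y);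
  tensm_comp : forall X X' X'' Y Y' Y'' (f' : hom X' X'') (f : hom X X')
      (g' : hom Y' Y'') (g : hom Y Y'),
    tensm (f' ∘ f) (g' ∘ g) = tensm f' g' ∘ tensm f g;
  massoc_nat : forall X X' Y Y' Z Z'
      (f : hom X X') (g : hom Y Y') (h : hom Z Z'),
    massoc X' Y' Z' ∘ tensm (tensm f g) h
    = tensm f (tensm g h) ∘ massoc X Y Z;
  mlunit_nat : forall X Y (f : hom X Y),
    mlunit Y ∘ tensm (idm munit) f = f ∘ mlunit X;
  mrunit_nat : forall X Y (f : hom X Y),
    mrunit Y ∘ tensm f (idm munit) = f ∘ mrunit X;
  msym_nat : forall X X' Y Y' (f : hom X X') (g : hom Y Y'),
    msym X' Y' ∘ tensm f g = tensm g f ∘ msym X Y;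
  mpentagon : forall X Y Z W,
    massoc X Y (tens Z W) ∘ massoc (tens X Y) Z W
    = tensm (idm X) (massoc Y Z W) ∘ massoc X (tens Y Z) W
      ∘ tensm (massoc X Y Z) (idm W);
  mtriangle : forall X Y,
    tensm (idm X) (mlunit Y) ∘ massoc X munit Y = tensm (mrunit X) (idm Y);
  msymK : forall X Y, msym Y X ∘ msym X Y = idm (tens X Y);
  mhexagon : forall X Y Z,
    massoc Y Z X ∘ msym X (tens Y Z) ∘ massoc X Y Z
    = tensm (idm Y) (msym X Z) ∘ massoc Y X Z ∘ tensm (msym X Y) (idm Z) }.

Notation "X ⊗ Y" := (tens X Y) : cat_scope.
Notation "f ⊗₁ g" := (tensm f g) : cat_scope.
Arguments munit {s}.

(* [X ⊗ msym X Y ⊗ Y] with the associators written out. *)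
Definition mswap (C : sym_monoidal_category) (X Y : C) :
    hom ((X ⊗ X) ⊗ (Y ⊗ Y)) ((X ⊗ Y) ⊗ (X ⊗ Y)) :=
  iso_inv (massoc X Y (X ⊗ Y))
  ∘ (idm X ⊗₁ (massoc Y X Y ∘ (msym X Y ⊗₁ idm Y) ∘ iso_inv (massoc X Y Y)))
  ∘ massoc X X (Y ⊗ Y).

Record sym_monoidal_functor (C D : sym_monoidal_category) :=
  SymMonoidalFunctor {
  smf_functor :> functor C D;
  smf_tens : forall X Y : C,
    iso (smf_functor X ⊗ smf_functor Y) (smf_functor (X ⊗ Y));
  smf_unit : iso munit (smf_functor munit);
  smf_tens_nat : forall (X X' Y Y' : C) (f : hom X X') (g : hom Y Y'),
    smf_tens X' Y' ∘ (fmap smf_functor f ⊗₁ fmap smf_functor g)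
    = fmap smf_functor (f ⊗₁ g) ∘ smf_tens X Y;
  smf_assoc : forall X Y Z : C,
    fmap smf_functor (massoc X Y Z) ∘ smf_tens (X ⊗ Y) Z
      ∘ (smf_tens X Y ⊗₁ idm (smf_functor Z))
    = smf_tens X (Y ⊗ Z) ∘ (idm (smf_functor X) ⊗₁ smf_tens Y Z)
      ∘ massoc (smf_functor X) (smf_functor Y) (smf_functor Z);
  smf_lunit : forall X : C,
    fmap smf_functor (mlunit X) ∘ smf_tens munit X
      ∘ (smf_unit ⊗₁ idm (smf_functor X))
    = mlunit (smf_functor X);
  smf_runit : forall X : C,
    fmap smf_functor (mrunit X) ∘ smf_tens X munit
      ∘ (idm (smf_functor X) ⊗₁ smf_unit)
    = mrunit (smf_functor X);
  smf_sym : forall X Y : C,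
    fmap smf_functor (msym X Y) ∘ smf_tens X Y
    = smf_tens Y X ∘ msym (smf_functor X) (smf_functor Y) }.

(* Only asks for some isomorphism; a symmetric monoidal functor provides
   the coherent one [smf_unit]. *)
Definition preserves_unit (C D : sym_monoidal_category) (F : functor C D)
    : Prop :=
  inhabited (iso (munit : D) (F munit)).

(** * Markov categories *)

Record markov_category := MarkovCategory {
  mkv_smc :> sym_monoidal_category;
  copy : forall X : mkv_smc, hom X (X ⊗ X);
  del : forall X : mkv_smc, hom X munit;
  copy_coassoc : forall X,
    massoc X X X ∘ (copy X ⊗₁ idm X) ∘ copy X = (idm X ⊗₁ copy X) ∘ copy X;
  copy_counitl : forall X, mlunit X ∘ (del X ⊗₁ idm X) ∘ copy X = idm X;
  copy_counitr : forall X, mrunit X ∘ (idm X ⊗₁ del X) ∘ copy X = idm X;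
  copy_comm : forall X, msym X X ∘ copy X = copy X;
  del_tens : forall X Y, del (X ⊗ Y) = mlunit munit ∘ (del X ⊗₁ del Y);
  copy_tens : forall X Y, copy (X ⊗ Y) = mswap X Y ∘ (copy X ⊗₁ copy Y);
  del_nat : forall X Y (f : hom X Y), del Y ∘ f = del X }.

Record markov_functor (C D : markov_category) := MarkovFunctor {
  mkvf_smf :> sym_monoidal_functor C D;
  mkvf_copy : forall X : C,
    iso_inv (smf_tens mkvf_smf X X) ∘ fmap mkvf_smf (copy X)
    = copy (mkvf_smf X) }.

(** * Deterministic morphisms *)

Section Deterministic.
Variable C : markov_category.

Definition deterministic (X Y : C) (f : hom X Y) : Prop :=
  copy Y ∘ f = (f ⊗₁ f) ∘ copy X.

Lemma deterministic_id (X : C) : deterministic (idm X).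
Proof. by rewrite /deterministic compm_idr tensm_id compm_idl. Qed.

Lemma deterministic_comp (X Y Z : C) (g : hom Y Z) (f : hom X Y) :
  deterministic g -> deterministic f -> deterministic (g ∘ f).
Proof.
rewrite /deterministic => dg df.
by rewrite compmA dg -compmA df compmA -tensm_comp.
Qed.

Lemma massoc_inv_nat (X X' Y Y' Z Z' : C)
    (f : hom X X') (g : hom Y Y') (h : hom Z Z') :
  iso_inv (massoc X' Y' Z') ∘ (f ⊗₁ (g ⊗₁ h))
  = ((f ⊗₁ g) ⊗₁ h) ∘ iso_inv (massoc X Y Z).
Proof.
rewrite -[LHS]compm_idr -(iso_homK (massoc X Y Z)) compmA.
by rewrite -(compmA _ _ (iso_hom _)) -massoc_nat compmA iso_invK compm_idl.
Qed.

Lemma mswap_nat (X X' Y Y' : C) (f : hom X X') (g : hom Y Y') :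
  mswap X' Y' ∘ ((f ⊗₁ f) ⊗₁ (g ⊗₁ g))
  = ((f ⊗₁ g) ⊗₁ (f ⊗₁ g)) ∘ mswap X Y.
Proof.
rewrite /mswap -compmA massoc_nat !compmA -massoc_inv_nat; congr (_ ∘ _).
rewrite -!compmA; congr (_ ∘ _); rewrite -!tensm_comp compm_idl compm_idr.
congr (_ ⊗₁ _); rewrite -!compmA massoc_inv_nat !compmA -massoc_nat.
congr (_ ∘ _); rewrite -!compmA; congr (_ ∘ _).
by rewrite -!tensm_comp msym_nat compm_idl compm_idr.
Qed.

Lemma deterministic_tens (X X' Y Y' : C) (f : hom X X') (g : hom Y Y') :
  deterministic f -> deterministic g -> deterministic (f ⊗₁ g).
Proof.
rewrite /deterministic => df dg.
rewrite !copy_tens -compmA -tensm_comp df dg tensm_comp.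
by rewrite [LHS]compmA mswap_nat -[LHS]compmA.
Qed.

Definition det_hom (X Y : C) : Type := {f : hom X Y | deterministic f}.

Lemma det_hom_eq (X Y : C) (f g : det_hom X Y) : sval f = sval g -> f = g.
Proof.
case: f g => [f df] [g dg] /= fg; case: g / fg dg => dg.
by rewrite (ProofIrrelevance.proof_irrelevance _ df dg).
Qed.

Definition det_id (X : C) : det_hom X X := exist _ _ (deterministic_id X).

Definition det_comp (X Y Z : C) (g : det_hom Y Z) (f : det_hom X Y) :
    det_hom X Z :=
  exist _ _ (deterministic_comp (svalP g) (svalP f)).

Definition det_category : category.
Proof.
refine (@Category C det_hom det_id det_comp _ _ _).
- by move=> X Y f; apply: det_hom_eq; apply: compm_idl.
- by move=> X Y f; apply: det_hom_eq; apply: compm_idr.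
- by move=> X Y Z W h g f; apply: det_hom_eq; apply: compmA.
Defined.

Definition det_incl : functor det_category C.
Proof.
exact: (@Functor det_category C (fun X => X) (fun X Y f => sval f)
  (fun X => erefl) (fun X Y Z g f => erefl)).
Defined.

Definition det_tensor_left (A : C) : functor det_category det_category.
Proof.
refine (@Functor det_category det_category (fun X => A ⊗ X)
  (fun X Y f => exist _ (idm A ⊗₁ sval f)
     (deterministic_tens (deterministic_id A) (svalP f))) _ _).
- by move=> X; apply: det_hom_eq; apply: tensm_id.
- move=> X Y Z g f; apply: det_hom_eq => /=.
  by rewrite -tensm_comp compm_idl.
Defined.

End Deterministic.

(* Given the first two conditions, requiring preservation by the endofunctor
   [A ⊗ -] of [det_category C] or by its composite with the inclusion is
   equivalent: inverses of deterministic isomorphisms are deterministic. *)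
Definition distributive (C : markov_category) : Prop :=
  [/\ has_finite_coproducts (det_category C),
      preserves_finite_coproducts (det_incl C)
    & forall A : C, preserves_finite_coproducts (det_tensor_left A)].

(** * Coinflip structures *)

Record midpoint_algebra (A : Type) (m : A -> A -> A) : Prop :=
  MidpointAlgebra {
  midpoint_idem : forall a, m a a = a;
  midpoint_comm : forall a b, m a b = m b a;
  midpoint_medial : forall a b c d,
    m (m a b) (m c d) = m (m a c) (m b d) }.

Definition midpoint_hom (A B : Type) (mA : A -> A -> A) (mB : B -> B -> B)
    (h : A -> B) : Prop :=
  forall a b, h (mA a b) = mB (h a) (h b).

Record coinflip_structure (C : markov_category) := CoinflipStructure {
  flip :> forall X Y : C, hom X Y -> hom X Y -> hom X Y;
  flip_midpoint : forall X Y : C, midpoint_algebra (@flip X Y);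
  flip_post : forall (X Y Z : C) (g : hom Y Z),
    midpoint_hom (@flip X Y) (@flip X Z) (fun f => g ∘ f);
  flip_pre : forall (X Y Z : C) (f : hom X Y),
    midpoint_hom (@flip Y Z) (@flip X Z) (fun g => g ∘ f) }.

Arguments flip {C} m {X Y} f g : rename.

(* Main.v *)
Require Import Defs.
From mathcomp Require Import all_boot.

Set Implicit Arguments.
Unset Strict Implicit.
Unset Printing Implicit Defensive.

Local Open Scope cat_scope.

(** The coinflip [flip m f g] factors as [h ∘ flip m i0 i1], where [i0], [i1]
    are the injections of the copower [X + X] and [h] is the copairing of [f]
    and [g]. As [F] preserves the copower, only the universal coinflip
    [flip m i0 i1 : X -> X + X] has to be compared with its counterpart
    in [D].

    This universal coinflip is determined by two equations: it is invariant
    under the swap [s] of the two summands, and the codiagonal [d] retracts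
    it onto [idm X]. They express commutativity and idempotence, and any
    functor preserves them. That they characterize it
    ([swap_invariant_section_flip]) is an Eckmann-Hilton argument: if [c]
    satisfies them, then [c = flip m c (s ∘ c) = flip m (idm _) s ∘ c], and
    [flip m (idm _) s] factors through the codiagonal as
    [flip m i0 i1 ∘ d], so that [c = flip m i0 i1 ∘ (d ∘ c)]
    is [flip m i0 i1]. *)

Lemma flip_compl (C : markov_category) (m : coinflip_structure C)
    (X Y Z : C) (h : hom Y Z) (f g : hom X Y) :
  h ∘ flip m f g = flip m (h ∘ f) (h ∘ g).
Proof. exact: flip_post. Qed.

Lemma flip_compr (C : markov_category) (m : coinflip_structure C)
    (X Y Z : C) (f g : hom Y Z) (h : hom X Y) :
  flip m f g ∘ h = flip m (f ∘ h) (g ∘ h).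
Proof. exact: flip_pre. Qed.

Lemma flipxx (C : markov_category) (m : coinflip_structure C)
    (X Y : C) (f : hom X Y) : flip m f f = f.
Proof. exact: midpoint_idem (flip_midpoint m X Y) f. Qed.

Lemma flipC (C : markov_category) (m : coinflip_structure C)
    (X Y : C) (f g : hom X Y) : flip m f g = flip m g f.
Proof. exact: midpoint_comm (flip_midpoint m X Y) f g. Qed.

Section Copower.
Variables (C : category) (X P : C) (i : 'I_2 -> hom X P).
Hypothesis coprod_i : is_coproduct i.

Lemma copairing_ex (Z : C) (f g : hom X Z) :
  exists h : hom P Z, h ∘ i ord0 = f /\ h ∘ i ord_max = g.
Proof.
have [h [hi _]] := coprod_i (fun k => if k == ord0 then f else g).
by exists h; rewrite !hi.
Qed.

Lemma copower_joint_epi (Z : C) (h h' : hom P Z) :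
  h ∘ i ord0 = h' ∘ i ord0 -> h ∘ i ord_max = h' ∘ i ord_max -> h = h'.
Proof.
move=> eq0 eq1; have [k [_ k_uniq]] := coprod_i (fun j => h' ∘ i j).
rewrite -(k_uniq h') //; symmetry; apply: k_uniq => j.
have /orP[/eqP-> //|/eqP-> //] : (j == ord0) || (j == ord_max).
by case: j => [[|[|]]].
Qed.

End Copower.

(** The coproduct injections of a deterministic copower also form a copower
    for arbitrary morphisms, which is where [flip m i0 i1] lives. *)
Lemma distributive_copower_ex (C : markov_category) (X : C) :
  distributive C ->
  exists (P : C) (i : 'I_2 -> hom X P), is_coproduct i.
Proof.
case=> /(_ 2 (fun=> X)) [P [i coprod_i]] /(_ _ _ _ _ coprod_i) coprod_Ci _.
by exists P, (fun k => sval (i k)).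
Qed.

(** Uniqueness of the universal coinflip, with the swap [s] and the codiagonal
    [d] as arguments so that their images under a functor can be supplied. *)
Lemma swap_invariant_section_flip (C : markov_category)
    (m : coinflip_structure C) (X P : C) (i : 'I_2 -> hom X P)
    (s : hom P P) (d : hom P X) (c : hom X P) :
  is_coproduct i ->
  s ∘ i ord0 = i ord_max -> s ∘ i ord_max = i ord0 ->
  d ∘ i ord0 = idm X -> d ∘ i ord_max = idm X ->
  s ∘ c = c -> d ∘ c = idm X -> c = flip m (i ord0) (i ord_max).
Proof.
move=> coprod_i s0 s1 d0 d1 sc dc.
have flip_id_s : flip m (idm P) s = flip m (i ord0) (i ord_max) ∘ d.
  apply: (copower_joint_epi coprod_i).
    by rewrite flip_compr compm_idl s0 -compmA d0 compm_idr.
  by rewrite flip_compr compm_idl s1 -compmA d1 compm_idr flipC.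
rewrite -[LHS](flipxx m) -{2}sc -{1}[c]compm_idl -flip_compr flip_id_s.
by rewrite -compmA dc compm_idr.
Qed.

(** The swap and the codiagonal of the copower in [C] are carried along by
    [F], and with them the two equations that characterize the coinflip. *)
Lemma fmap_universal_flip (C D : markov_category)
    (mC : coinflip_structure C) (mD : coinflip_structure D)
    (F : functor C D) (X P : C) (i : 'I_2 -> hom X P) :
  is_coproduct i -> is_coproduct (fun k => fmap F (i k)) ->
  fmap F (flip mC (i ord0) (i ord_max))
  = flip mD (fmap F (i ord0)) (fmap F (i ord_max)).
Proof.
move=> coprod_i coprod_Fi.
have [s [s0 s1]] := copairing_ex coprod_i (i ord_max) (i ord0).
have [d [d0 d1]] := copairing_ex coprod_i (idm X) (idm X).
apply: (swap_invariant_section_flip mD (s := fmap F s) (d := fmap F d)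
    coprod_Fi);
  rewrite -?fmap_comp -?fmap_id; congr (fmap F _) => //.
- by rewrite flip_compl s0 s1 flipC.
- by rewrite flip_compl d0 d1 flipxx.
Qed.

(* The coinflip structure of a coinflip Markov category is unique, so "the"
   structures of C and D are rendered by arbitrary ones mC and mD. *)
Theorem corollary4p8 (C D : markov_category)
  (mC : coinflip_structure C) (mD : coinflip_structure D)
  (distrC : distributive C) (distrD : distributive D)
  (F : markov_functor C D)
  (F_coprod : preserves_finite_coproducts F)
  (F_unit : preserves_unit F)
  (X Y : C) (f g : hom X Y) :
  fmap F (flip mC f g) = flip mD (fmap F f) (fmap F g).
Proof.
have [P [i coprod_i]] := distributive_copower_ex X distrC.
have [h [<- <-]] := copairing_ex coprod_i f g.
rewrite -flip_compl !fmap_comp -flip_compl; congr (_ ∘ _).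
exact: fmap_universal_flip coprod_i (F_coprod _ _ _ _ coprod_i).
Qed.
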